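(* Let $X$ be a finite set, $\theta:[t_1,\infty)\to\Pi_X$ a sequence of partitions of $X$ with associated complexes $K^{s,t}$, and let $t_1\le s\le t$. (i) $\mathrm{HF}_1(s,t)\ge1$ if and only if $\theta$ has a 1-conflict in $[s,t]$. (ii) If $\theta$ has a 1-conflict in $[s,t]$, then it also has a triangle 0-conflict in $[s,t]$. (iii) If $\theta$ is hierarchical in $[s,t]$, then $\mathrm{HF}_1(s,t)=0$.
   Context: $X=\{x_1,\dots,x_N\}$ is a finite set and $\Pi_X$ is the set of partitions of $X$ (into nonempty clusters). Refinement order: $\pi\le\pi'$ if every cluster of $\pi$ is contained in a cluster of $\pi'$. A sequence of partitions is a piecewise-constant map $\theta:[t_1,\infty)\to\Pi_X$ with change points $t_1<\dots<t_M$: $\theta(t)=\theta(t_m)$ for $t\in[t_m,t_{m+1})$, $1\le m\le M-1$, and $\theta(t)=\theta(t_M)$ for $t\ge t_M$. Write $x\sim_r y$ if $x,y$ lie in a common cluster of $\theta(r)$. For $t_1\le s\le t$, $K^{s,t}:=\bigcup_{s\le r\le t}\bigcup_{C\in\theta(r)}\Delta C$, where $\Delta C:=2^C$ is the solid simplex on $C$. $\mathrm{HF}_k(s,t):=\dim H_k(K^{s,t})$, where $H_k=Z_k/B_k$ is simplicial homology with coefficients in a fixed field ($Z_k$: $k$-cycles, $B_k$: $k$-boundaries). 1-conflict: $\theta$ has a 1-conflict in $[s,t]$ if there exist $x_1,\dots,x_n\in X$ such that the 1-cycle $z=[x_1,x_2]+\dots+[x_{n-1},x_n]+[x_n,x_1]\in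 Z_1(K^{s,t})$ is non-bounding, i.e. $[z]\ne0$ in $H_1(K^{s,t})$. Triangle 0-conflict: $\theta$ has a triangle 0-conflict in $[s,t]$ if there exist $x,y,z\in X$ such that there are $r_1,r_2\in[s,t]$ with $x\sim_{r_1}y$ and $y\sim_{r_2}z$, but there is no $r\in[s,t]$ with $x\sim_r y\sim_r z$. $\theta$ is hierarchical in $[s,t]$ if either $\theta(r_1)\le\theta(r_2)$ for all $r_1\le r_2$ in $[s,t]$, or $\theta(r_1)\ge\theta(r_2)$ for all $r_1\le r_2$ in $[s,t]$. *)

(* Defs.v *)
From HB Require Import structures.
From mathcomp Require Import all_boot all_order all_algebra.
From mathcomp Require Import boolp reals.

Set Implicit Arguments.
Unset Strict Implicit.
Unset Printing Implicit Defensive.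

Import Order.TTheory GRing.Theory Num.Theory.
Local Open Scope ring_scope.
Local Open Scope quotient_scope.

Section QuotientSpace.
Variables (F : fieldType) (vT : vectType F).

(* ring_quotient only provides the additive structure of {quot V}; the scaling
   and the dimension (codimension of V) are added below. *)
Definition vquot (V : {vspace vT}) : Type :=
  Quotient.quot (pred_of_vspace V : zmodClosed vT).

Variable V : {vspace vT}.
Local Notation Q := (vquot V).

HB.instance Definition _ := ZmodQuotient.on Q.

Definition vclass (u : vT) : Q := \pi_Q u.

Lemma vclass_eq u v : (vclass u == vclass v) = (u - v \in V).
Proof. by rewrite /vclass -Quotient.idealrBE. Qed.

Lemma vclassP (x : Q) : {u | x = vclass u}.
Proof. by exists (repr x); rewrite /vclass reprK. Qed.

Lemma vclassD u v : vclass (u + v) = vclass u + vclass v.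
Proof. by rewrite /vclass !piE. Qed.

Definition vquot_scale (a : F) (x : Q) : Q := vclass (a *: repr x).

Lemma vquot_scaleE a u : vquot_scale a (vclass u) = vclass (a *: u).
Proof.
apply/eqP; rewrite vclass_eq -scalerBr memvZ // -vclass_eq.
by rewrite /vclass reprK.
Qed.

Fact vquot_scaleA a b x :
  vquot_scale a (vquot_scale b x) = vquot_scale (a * b) x.
Proof. by have [u ->] := vclassP x; rewrite !vquot_scaleE scalerA. Qed.

Fact vquot_scale1 : left_id 1 vquot_scale.
Proof. by move=> x; have [u ->] := vclassP x; rewrite vquot_scaleE scale1r. Qed.

Fact vquot_scaleDr : right_distributive vquot_scale +%R.
Proof.
move=> a x y; have [u ->] := vclassP x; have [v ->] := vclassP y.
by rewrite -vclassD !vquot_scaleE scalerDr vclassD.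
Qed.

Fact vquot_scaleDl x : {morph vquot_scale^~ x : a b / a + b}.
Proof.
by move=> a b; have [u ->] := vclassP x; rewrite !vquot_scaleE scalerDl vclassD.
Qed.

HB.instance Definition _ := GRing.Zmodule_isLmodule.Build F Q
  vquot_scaleA vquot_scale1 vquot_scaleDr vquot_scaleDl.

Fact vclass_is_linear : linear vclass.
Proof. by move=> a u v; rewrite vclassD -vquot_scaleE. Qed.

HB.instance Definition _ := GRing.isLinear.Build F vT Q _ vclass
  vclass_is_linear.

Fact vquot_vect_iso : Vector.axiom (\dim V^C) Q.
Proof.
pose res u : subvs_of V^C := vsproj V^C (u - projv V u).
have resE u : vsval (res u) = u - projv V u by rewrite vsprojK ?memv_projC.
have res_lin a u v : res (a *: u + v) = a *: res u + res v.
  rewrite /res -[RHS]linearP; congr vsproj.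
  by rewrite linearP scalerBr opprD addrACA.
have res_repr u : res (repr (vclass u)) = res u.
  apply: val_inj; rewrite /= !resE.
  have /projv_id : repr (vclass u) - u \in V by rewrite -vclass_eq /vclass reprK.
  rewrite raddfB /= => e.
  apply/eqP; rewrite -subr_eq0 opprB [projv V u - u]addrC addrACA -e.
  by rewrite -[X in _ + X]opprK opprD opprK subrr.
have resK u : vclass (vsval (res u)) = vclass u.
  apply/eqP; rewrite vclass_eq resE addrAC subrr add0r memvN.
  exact: memv_proj.
have [f f_lin f_bij] := subvs_vect_iso V^C.
exists (fun x : Q => f (res (repr x))).
  move=> a x y; have [u ->] := vclassP x; have [v ->] := vclassP y.
  by rewrite -(vclass_is_linear a u v) !res_repr res_lin f_lin.
have [g fK gK] := f_bij.
exists (fun r => vclass (vsval (g r))) => [x|r].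
  by have [u ->] := vclassP x; rewrite res_repr fK resK.
rewrite res_repr; suff -> : res (vsval (g r)) = g r by rewrite gK.
apply: val_inj; rewrite /= resE.
suff /eqP -> : projv V (vsval (g r)) == 0 by rewrite subr0.
by rewrite -memv_ker lker_proj subvsP.
Qed.

HB.instance Definition _ := Lmodule_hasFinDim.Build F Q vquot_vect_iso.

Lemma dim_vquot : \dim {: Q} = \dim V^C.
Proof. by rewrite dimvf. Qed.

End QuotientSpace.

Section Homology.
Variables (F : fieldType) (T : finType).
Implicit Types (A : {set T}) (K : {set {set T}}) (x y : T) (k : nat).

(* Coefficient functions on all subsets of T. A simplex stands for the oriented
   simplex [a_0, ..., a_k] whose vertices are listed in the order of enum T. *)
Definition chain : vectType F := {ffun {set T} -> F^o}.

Definition simplex A : chain := [ffun B => (B == A)%:R].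

Definition vpos x A : nat := #|[set y in A | (enum_rank y < enum_rank x)%N]|.

(* Homology is not reduced: the empty face of a vertex is discarded, so that
   the boundary of a 0-chain is 0. *)
Definition simplex_boundary A : chain :=
  \sum_(x in A | A :\ x != set0) (-1) ^+ vpos x A *: simplex (A :\ x).

Definition boundary_fun (c : chain) : chain :=
  \sum_(A : {set T}) (c A : F) *: simplex_boundary A.

Fact boundary_fun_is_linear : linear boundary_fun.
Proof.
move=> a c d; rewrite /boundary_fun scaler_sumr -big_split /=.
by apply: eq_bigr => A _; rewrite !ffunE scalerDl scalerA.
Qed.

HB.instance Definition _ := GRing.isLinear.Build F chain chain _ boundary_fun
  boundary_fun_is_linear.

Definition boundary : 'End(chain) := linfun boundary_fun.

Definition chains K k : {vspace chain} :=
  <<[seq simplex A | A <- enum K & #|A| == k.+1]>>%VS.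

Definition cycles K k : {vspace chain} := (chains K k :&: lker boundary)%VS.

Definition boundaries K k : {vspace chain} := (boundary @: chains K k.+1)%VS.

Definition homology K k : vectType F :=
  vquot (linfun (@vsval _ _ (cycles K k)) @^-1: boundaries K k)%VS.

Definition hclass K k (z : subvs_of (cycles K k)) : homology K k := vclass _ z.

Lemma hclass_eq0 K k (z : subvs_of (cycles K k)) :
  (hclass z == 0) = (vsval z \in boundaries K k).
Proof.
rewrite -[0 in LHS](linear0 (vclass _)) vclass_eq subr0.
by rewrite -memv_preim lfunE.
Qed.

Lemma boundary_simplex A : boundary (simplex A) = simplex_boundary A.
Proof.
rewrite lfunE /= /boundary_fun (bigD1 A) //= ffunE eqxx scale1r.
by rewrite big1 ?addr0 // => B nBA; rewrite ffunE (negPf nBA) scale0r.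
Qed.

(* [x, y] = - [y, x], and [x, x] = 0. *)
Definition oriented_edge x y : chain :=
  if x == y then 0
  else if (enum_rank x < enum_rank y)%N then simplex [set x; y]
  else - simplex [set x; y].

Fact vposD1 x y A : (enum_rank x < enum_rank y)%N -> x \in A ->
  vpos y A = (vpos y (A :\ x)).+1 /\ vpos x (A :\ y) = vpos x A.
Proof.
move=> ltxy xA; split.
  rewrite /vpos (cardsD1 x) !inE xA ltxy add1n; congr _.+1.
  by apply: eq_card => z; rewrite !inE andbA.
apply: eq_card => z; rewrite !inE; case: eqP => [->|_] //=.
by rewrite ltnNge ltnW // andbF.
Qed.

Fact boundary_simplex2 x y : (enum_rank x < enum_rank y)%N ->
  boundary (simplex [set x; y]) = simplex [set y] - simplex [set x].
Proof.
move=> ltxy; have nxy : x != y by apply: contraTneq ltxy => ->; rewrite ltnn.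
have Dx : [set x; y] :\ x = [set y].
  by apply/setP=> z; rewrite !inE; case: eqP => [->|//]; rewrite (negPf nxy).
have Dy : [set x; y] :\ y = [set x].
  apply/setP=> z; rewrite !inE orbC; case: eqP => [->|//].
  by rewrite eq_sym (negPf nxy).
have [pyE pxE] := vposD1 ltxy (set21 x y).
have vpos1 z : vpos z [set z] = 0%N.
  by apply: eq_card0 => w; rewrite !inE; case: eqP => // ->; rewrite ltnn.
rewrite Dx Dy !vpos1 in pyE pxE.
have set1n0 z : [set z] != set0 by apply/set0Pn; exists z; rewrite inE.
rewrite boundary_simplex /simplex_boundary.
rewrite (bigD1 x) /=; last by rewrite Dx set1n0 set21.
rewrite (bigD1 y) /=; last by rewrite Dy set1n0 set22 eq_sym nxy.
rewrite big1 ?addr0 => [|z]; first by rewrite Dx Dy pyE -pxE scale1r scaleN1r.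
by rewrite !inE; case: eqP => //= _; case: eqP => //=; rewrite !(andbF, andFb).
Qed.

Lemma boundary_oriented_edge x y :
  boundary (oriented_edge x y) = simplex [set y] - simplex [set x].
Proof.
rewrite /oriented_edge; case: eqP => [->|/eqP nxy]; first by rewrite subrr linear0.
case: ltngtP => [ltxy|ltyx|/val_inj/enum_rank_inj/eqP]; last by rewrite (negPf nxy).
  by rewrite boundary_simplex2.
by rewrite linearN /= setUC boundary_simplex2 // opprB.
Qed.

Lemma boundary_boundary (c : chain) : boundary (boundary c) = 0.
Proof.
rewrite [boundary c]lfunE /= /boundary_fun linear_sum big1 //= => A _.
rewrite linearZ /=; apply/eqP; rewrite scaler_eq0; apply/orP; right; apply/eqP.
pose P x y := [&& x \in A, y \in A, x != y & A :\ x :\ y != set0].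
pose G x y : chain :=
  ((-1) ^+ vpos x A * (-1) ^+ vpos y (A :\ x)) *: simplex (A :\ x :\ y).
have PC x y : P x y = P y x.
  by rewrite /P eq_sym !setDDl [[set x] :|: _]setUC andbCA.
have -> : boundary (simplex_boundary A) = \sum_x \sum_(y | P x y) G x y.
  rewrite /simplex_boundary linear_sum big_mkcond /=; apply: eq_bigr => x _.
  case: ifPn => [/andP[xA _]|nx].
    rewrite linearZ /= boundary_simplex scaler_sumr.
    apply: eq_big => [y|y _]; last by rewrite scalerA.
    by rewrite /P in_setD1 xA eq_sym -andbA andbCA.
  rewrite big_pred0 // => y; apply: contraNF nx => /and4P[xA yA nxy _].
  by rewrite xA; apply/set0Pn; exists y; rewrite !inE eq_sym nxy.
pose lt x y := (enum_rank x < enum_rank y)%N.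
have GN x y : P x y -> lt x y -> G y x = - G x y.
  case/and4P=> xA yA _ _ ltxy; have [pyE pxE] := vposD1 ltxy xA.
  rewrite /G pyE pxE setDDl setUC -setDDl -scaleNr exprS mulN1r mulNr.
  by rewrite mulrC.
have -> : \sum_x \sum_(y | P x y) G x y =
    \sum_x \sum_(y | P x y && lt x y) G x y +
    \sum_x \sum_(y | P x y && ~~ lt x y) G x y.
  by rewrite -big_split /=; apply: eq_bigr => x _; rewrite (bigID (lt x)).
rewrite [X in _ + X](exchange_big_dep predT) //= -big_split big1 //= => x _.
have -> : \sum_(y | P y x && ~~ lt y x) G y x = \sum_(y | P x y && lt x y) - G x y.
  apply: eq_big => [y|y].
    rewrite PC; case Pxy: (P x y) => //=; rewrite -leqNgt leq_eqVlt.
    by case: eqP Pxy => [/val_inj/enum_rank_inj->|//]; rewrite /P eqxx !andbF.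
  case/andP; rewrite PC => Pxy nlt; rewrite GN // /lt ltn_neqAle leqNgt nlt andbT.
  case/and4P: Pxy => _ _ nxy _.
  by apply: contraNneq nxy => /val_inj/enum_rank_inj->.
by rewrite sumrN subrr.
Qed.

Lemma boundaries_sub_cycles K k :
  (forall A B : {set T}, A \in K -> B \subset A -> B \in K) ->
  (boundaries K k <= cycles K k)%VS.
Proof.
move=> Kdown; apply/subvP => _ /memv_imgP[c cC ->].
rewrite memv_cap memv_ker boundary_boundary eqxx andbT.
move: c cC; suff /subvP sub : (chains K k.+1 <= boundary @^-1: chains K k)%VS.
  by move=> c /sub; rewrite memv_preim.
apply/span_subvP => _ /mapP[A + ->].
rewrite mem_filter mem_enum => /andP[/eqP cardA AK].
rewrite -memv_preim boundary_simplex; apply: memv_suml => x /andP[xA _].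
apply/memvZ/memv_span/map_f; rewrite mem_filter mem_enum.
rewrite (Kdown _ _ AK (subD1set A x)) andbT.
by rewrite -eqSS -cardA (cardsD1 x A) xA.
Qed.

End Homology.

Section PartitionSequences.
Variables (R : realType) (T : finType).
Implicit Types (theta : R -> {set {set T}}) (s t r : R).

(* The change points are tp 1 < ... < tp M; theta is only constrained on
   [tp 1, +oo). *)
Definition is_partition_sequence (M : nat) (tp : nat -> R) theta : Prop :=
  [/\ (0 < M)%N,
      forall m, (0 < m < M)%N -> tp m < tp m.+1,
      forall r, tp 1%N <= r -> partition (theta r) [set: T],
      forall m, (0 < m < M)%N ->
        forall r, tp m <= r < tp m.+1 -> theta r = theta (tp m) &
      forall r, tp M <= r -> theta r = theta (tp M)].

Definition refines (P Q : {set {set T}}) : Prop :=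
  forall C, C \in P -> exists2 D, D \in Q & C \subset D.

Definition same_cluster theta r (x y : T) : Prop :=
  exists C, [/\ C \in theta r, x \in C & y \in C].

(* Contains the empty simplex, which generates no chain group in degree
   k >= 0. *)
Definition sequence_complex theta s t : {set {set T}} :=
  [set A | `[< exists r C, [/\ s <= r <= t, C \in theta r & A \in powerset C] >]].

Lemma sequence_complex_down theta s t (A B : {set T}) :
  A \in sequence_complex theta s t -> B \subset A ->
  B \in sequence_complex theta s t.
Proof.
rewrite !inE => /asboolP[r [C [rst CT AC]]] BA; apply/asboolP.
exists r, C; split=> //; move: AC; rewrite !inE; exact: subset_trans.
Qed.

Definition HF (F : fieldType) (k : nat) theta s t : nat :=
  \dim {: homology F (sequence_complex theta s t) k}.

(* Indices are cyclic: ordS maps n.-1 to 0. *)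
Definition one_conflict (F : fieldType) theta s t : Prop :=
  let K := sequence_complex theta s t in
  exists (n : nat) (x : 'I_n -> T),
    (forall i, oriented_edge F (x i) (x (ordS i)) \in chains F K 1) /\
    exists2 z : subvs_of (cycles F K 1),
      vsval z = \sum_(i < n) oriented_edge F (x i) (x (ordS i)) &
      hclass z != 0.

Definition triangle_zero_conflict theta s t : Prop :=
  exists x y z : T,
    (exists r1 r2, [/\ s <= r1 <= t, s <= r2 <= t,
                       same_cluster theta r1 x y & same_cluster theta r2 y z]) /\
    ~ (exists r, [/\ s <= r <= t, same_cluster theta r x y &
                     same_cluster theta r y z]).

Definition hierarchical theta s t : Prop :=
  (forall r1 r2, s <= r1 -> r1 <= r2 -> r2 <= t ->
     refines (theta r1) (theta r2)) \/
  (forall r1 r2, s <= r1 -> r1 <= r2 -> r2 <= t ->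
     refines (theta r2) (theta r1)).

End PartitionSequences.

(* Main.v *)
Require Import Defs.
From HB Require Import structures.
From mathcomp Require Import all_boot all_order all_algebra.
From mathcomp Require Import boolp reals.

(** Part (i) says that a first homology group is nonzero exactly when some
    closed walk fails to bound, so the point is that closed walks span the
    1-cycles. Choose in every connected component of the edge graph a root, and
    for every vertex x a walk from the root to x, with chain P_x. Let h be the
    linear map sending the 0-chain [x] to P_x. For an edge xy,
      [x, y] - h (d [x, y]) = P_x + [x, y] - P_y
    is the chain of a closed walk: out to x, across the edge, back from y. By
    linearity c - h (d c) is a combination of closed walks for every 1-chain c,
    and it equals c when c is a cycle. The argument works over any field
    (cycles1_sub_loops).

    For part (ii), suppose that there is no triangle 0-conflict. If xy and yz are
    edges of the complex, then x, y, z lie together in one cluster of one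
    partition, so xyz is a face and xz is an edge. Adjacency is thus transitive;
    every vertex of a closed walk is adjacent to its first vertex, and all the
    triangles of the cone from that vertex over the walk are faces. Their
    boundaries add up to the walk, because the spokes cancel (loop_chain_cone).

    For part (iii), in a hierarchical sequence two clusters seen at times r1 and
    r2 are both seen, up to enlargement, at whichever of the two times carries
    the coarser partition. This excludes triangle 0-conflicts, hence 1-conflicts
    by (ii), hence first homology by (i). *)

Set Implicit Arguments.
Unset Strict Implicit.
Unset Printing Implicit Defensive.

Import Order.TTheory GRing.Theory Num.Theory.
Local Open Scope ring_scope.

(** * Chains, oriented edges and triangles *)

Section Chains.
Variables (F : fieldType) (T : finType).
Implicit Types (K : {set {set T}}) (x y z : T).

Lemma oriented_edgexx x : oriented_edge F x x = 0.
Proof. by rewrite /oriented_edge eqxx. Qed.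

Lemma oriented_edgeC x y : oriented_edge F y x = - oriented_edge F x y.
Proof.
rewrite /oriented_edge eq_sym; case: eqP => [_|/eqP nxy]; first by rewrite oppr0.
rewrite [[set y; x]]setUC.
case: ltngtP => [_|//|/val_inj/enum_rank_inj e]; first by rewrite opprK.
by rewrite e eqxx in nxy.
Qed.

(** The simplices are linearly independent: a chain lying in the span of the
    k-simplices of K is supported on them. This is how membership of an edge
    chain in the chain group is turned back into membership of the edge in K. *)
Lemma chains_support K k (c : chain F T) (A : {set T}) :
  c \in chains F K k -> c A != 0 -> A \in K /\ #|A| = k.+1.
Proof.
move=> cC cA.
suff : ~~ ((A \in K) && (#|A| == k.+1)) -> c A = 0.
  move=> supp.
  have [/andP[AK /eqP] //|/supp/eqP] := boolP ((A \in K) && (#|A| == k.+1)).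
  by rewrite (negPf cA).
move=> nA {cA}; pose faces := [seq B : {set T} <- enum K | #|B| == k.+1].
have cS : c \in <<in_tuple [seq simplex F B | B <- faces]>>%VS := cC.
rewrite (coord_span cS) sum_ffunE big1 // => i _.
have ltif : (i < size faces)%N by rewrite -(size_map (@simplex F T)) ltn_ord.
rewrite ffunE (nth_map set0) // ffunE.
case: eqP => [E|_]; last by rewrite scaler0.
by have := mem_nth set0 ltif; rewrite -E mem_filter mem_enum andbC (negPf nA).
Qed.

Lemma simplex_chains K k (A : {set T}) :
  A \in K -> #|A| = k.+1 -> simplex F A \in chains F K k.
Proof.
by move=> AK cA; apply/memv_span/map_f; rewrite mem_filter mem_enum AK cA eqxx.
Qed.

Lemma oriented_edge_chains K x y :
  (oriented_edge F x y \in chains F K 1) = (x == y) || ([set x; y] \in K).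
Proof.
apply/idP/idP => [|/orP[/eqP->|xyK]]; last 2 first.
- by rewrite oriented_edgexx mem0v.
- rewrite /oriented_edge; case: (eqVneq x y) => [_|nxy]; first exact: mem0v.
  have sC : simplex F [set x; y] \in chains F K 1.
    by apply: simplex_chains; rewrite ?cards2 ?nxy.
  by case: ifP; rewrite ?memvN.
case: (eqVneq x y) => //= nxy eC.
have [] // := @chains_support K 1 _ [set x; y] eC.
rewrite /oriented_edge (negPf nxy).
by case: ifP => _; rewrite !ffunE eqxx ?oppr_eq0 oner_neq0.
Qed.

Lemma simplex2_oriented (A : {set T}) :
  #|A| = 2%N -> exists x y, A = [set x; y] /\ simplex F A = oriented_edge F x y.
Proof.
move=> /eqP/cards2P[x [y [nxy ->]]].
have [ltxy|] := boolP (enum_rank x < enum_rank y)%N.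
  by exists x, y; split; rewrite // /oriented_edge (negPf nxy) ltxy.
rewrite -leqNgt leq_eqVlt => /orP[/eqP/val_inj/enum_rank_inj e|ltyx].
  by rewrite e eqxx in nxy.
exists y, x; rewrite setUC; split=> //.
by rewrite /oriented_edge eq_sym (negPf nxy) ltyx.
Qed.

Definition triangle_chain x y z : chain F T :=
  oriented_edge F x y + oriented_edge F y z + oriented_edge F z x.

Lemma boundary_simplex3 x y z :
  (enum_rank x < enum_rank y)%N -> (enum_rank y < enum_rank z)%N ->
  boundary F T (simplex F [set x; y; z]) = triangle_chain x y z.
Proof.
move=> ltxy ltyz; have ltxz := ltn_trans ltxy ltyz.
have neq (u v : T) : (enum_rank u < enum_rank v)%N -> (u != v) * (v != u).
  move=> ltuv; rewrite [v == u]eq_sym.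
  by split; apply: contraTneq ltuv => ->; rewrite ltnn.
have [nxy nyx] := neq _ _ ltxy.
have [nyz nzy] := neq _ _ ltyz.
have [nxz nzx] := neq _ _ ltxz.
set A := [set x; y; z].
have Ax : A :\ x = [set y; z].
  apply/setP=> w; rewrite !inE; case: (eqVneq w x) => [->|_] //=.
  by rewrite (negPf nxy) (negPf nxz).
have Ay : A :\ y = [set x; z].
  apply/setP=> w; rewrite !inE; case: (eqVneq w y) => [->|_] //=;
    last by rewrite orbF.
  by rewrite (negPf nyx) (negPf nyz).
have Az : A :\ z = [set x; y].
  apply/setP=> w; rewrite !inE; case: (eqVneq w z) => [->|_] //=;
    last by rewrite orbF.
  by rewrite (negPf nzx) (negPf nzy).
have [xA yA zA] : [/\ x \in A, y \in A & z \in A] by rewrite !inE !eqxx !orbT.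
have vx : vpos x A = 0%N.
  apply: eq_card0 => w; rewrite !inE -orbA; apply/negP => /andP[/or3P[]/eqP->].
  - by rewrite ltnn.
  - by rewrite ltnNge ltnW.
  - by rewrite ltnNge ltnW.
have vy : vpos y A = 1%N.
  have [-> _] := vposD1 ltxy xA; congr _.+1; rewrite Ax.
  apply: eq_card0 => w; rewrite !inE; apply/negP => /andP[/orP[]/eqP->].
  - by rewrite ltnn.
  - by rewrite ltnNge ltnW.
have vz : vpos z A = 2%N.
  have [-> _] := vposD1 ltxz xA; congr _.+1; rewrite Ax.
  have [-> _] := vposD1 ltyz (set21 y z); congr _.+1.
  apply: eq_card0 => w; rewrite !inE; apply/negP => /andP[/andP[nwy /orP[]/eqP ew]].
  - by rewrite ew eqxx in nwy.
  - by rewrite ew ltnn.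
have nz2 u v : [set u; v] != set0 by apply/set0Pn; exists u; rewrite set21.
rewrite boundary_simplex /simplex_boundary.
rewrite (bigD1 x) /=; last by rewrite xA Ax nz2.
rewrite (bigD1 y) /=; last by rewrite yA Ay nz2 nyx.
rewrite (bigD1 z) /=; last by rewrite zA Az nz2 nzx nzy.
rewrite big1 ?addr0 => [|w]; last first.
  by rewrite !inE -!andbA => /and5P[/orP[/orP[]|]/eqP-> _]; rewrite ?eqxx.
rewrite Ax Ay Az vx vy vz expr0 expr1 sqrrN expr1n !scale1r scaleN1r.
rewrite /triangle_chain [oriented_edge F z x]oriented_edgeC /oriented_edge.
rewrite (negPf nxy) (negPf nyz) (negPf nxz) ltxy ltyz ltxz.
by rewrite [LHS]addrA [LHS]addrC addrA.
Qed.

Lemma triangle_chain_rot x y z : triangle_chain y z x = triangle_chain x y z.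
Proof. by rewrite /triangle_chain [LHS]addrC addrA. Qed.

Lemma triangle_chain_swap x y z : triangle_chain x z y = - triangle_chain x y z.
Proof.
rewrite /triangle_chain.
rewrite (oriented_edgeC z x) (oriented_edgeC y z) (oriented_edgeC x y).
by rewrite !opprD -addrA [LHS]addrC; congr (_ + _); exact: addrC.
Qed.

Lemma triangle_chain_degenerate x y : triangle_chain x x y = 0.
Proof.
by rewrite /triangle_chain oriented_edgexx add0r (oriented_edgeC x y) subrr.
Qed.

(** The chain of a triangle is alternating in its vertices, while the complex
    does not see their order, so it is enough to treat increasing vertices,
    where it is the boundary of the simplex, and repeated ones, where it is 0. *)
Lemma triangle_chain_boundaries K x y z :
  [set x; y; z] \in K -> triangle_chain x y z \in boundaries F K 1.
Proof.
pose bounds a b c :=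
  [set a; b; c] \in K -> triangle_chain a b c \in boundaries F K 1.
have bounds_rot a b c : bounds b c a -> bounds a b c.
  by rewrite /bounds triangle_chain_rot setUC setUA.
have bounds_swap a b c : bounds a c b -> bounds a b c.
  by rewrite /bounds triangle_chain_swap memvN setUAC.
have bounds_eq a c : bounds a a c.
  by move=> _; rewrite triangle_chain_degenerate mem0v.
pose lt (a b : T) := (enum_rank a < enum_rank b)%N.
have bounds_lt (a b c : T) : lt a b -> lt b c -> bounds a b c.
  move=> ltab ltbc abcK; rewrite -boundary_simplex3 // memv_img //.
  apply: simplex_chains => //; rewrite -setUA !cardsU1 cards1 !inE.
  have neq (u v : T) : lt u v -> (u == v) = false.
    by move=> ltuv; apply: contraTF ltuv => /eqP->; rewrite /lt ltnn.
  by rewrite (neq _ _ ltab) (neq _ _ ltbc) (neq _ _ (ltn_trans ltab ltbc)).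
suff: bounds x y z by [].
have [ltxy|ltyx|/val_inj/enum_rank_inj<-] :=
  ltngtP (enum_rank x) (enum_rank y); last first.
- exact: bounds_eq.
- have [ltyz|ltzy|/val_inj/enum_rank_inj<-] :=
    ltngtP (enum_rank y) (enum_rank z); last first.
  + exact/bounds_rot/bounds_eq.
  + exact/bounds_swap/bounds_rot/bounds_lt.
  have [ltxz|ltzx|/val_inj/enum_rank_inj<-] := ltngtP (enum_rank x) (enum_rank z).
  + exact/bounds_rot/bounds_swap/bounds_lt.
  + exact/bounds_rot/bounds_lt.
  + exact/bounds_swap/bounds_eq.
have [ltyz|ltzy|/val_inj/enum_rank_inj<-] :=
  ltngtP (enum_rank y) (enum_rank z); last first.
- exact/bounds_rot/bounds_eq.
- have [ltxz|ltzx|/val_inj/enum_rank_inj<-] := ltngtP (enum_rank x) (enum_rank z).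
  + exact/bounds_swap/bounds_lt.
  + exact/bounds_rot/bounds_rot/bounds_lt.
  + exact/bounds_swap/bounds_eq.
exact: bounds_lt.
Qed.

(** * Closed walks *)

Definition loop_chain n (x : 'I_n -> T) : chain F T :=
  \sum_(i < n) oriented_edge F (x i) (x (ordS i)).

Lemma loop_telescope (V : zmodType) n (f : 'I_n -> V) :
  \sum_(i < n) (f (ordS i) - f i) = 0.
Proof.
rewrite sumrB -(reindex (@ordS n) (P := predT) (F := f)) ?subrr //=.
exact/onW_bij/ordS_bij.
Qed.

Lemma loop_chain_cycles K n (x : 'I_n -> T) :
  (forall i, oriented_edge F (x i) (x (ordS i)) \in chains F K 1) ->
  loop_chain x \in cycles F K 1.
Proof.
move=> xK; rewrite memv_cap memv_suml //= memv_ker linear_sum /=.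
under eq_bigr do rewrite boundary_oriented_edge.
by rewrite (loop_telescope (fun i => simplex F [set x i])).
Qed.

(** The spokes [v, x_i] are each used twice, with opposite signs, so the loop is
    the sum of the triangles of the cone of apex v over it. *)
Lemma loop_chain_cone K v n (x : 'I_n -> T) :
  (forall i, [set v; x i; x (ordS i)] \in K) ->
  loop_chain x \in boundaries F K 1.
Proof.
move=> coneK.
have -> : loop_chain x = \sum_(i < n) triangle_chain v (x i) (x (ordS i)).
  rewrite -[RHS]addr0.
  rewrite -[X in _ + X](loop_telescope (fun i => oriented_edge F v (x i))).
  rewrite -big_split; apply: eq_bigr => i _ /=.
  rewrite /triangle_chain (oriented_edgeC v (x (ordS i))).
  by rewrite addrA subrK addrAC subrr add0r.
by apply: memv_suml => i _; exact: triangle_chain_boundaries.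
Qed.

Fixpoint walk_chain x (p : seq T) : chain F T :=
  if p is y :: q then oriented_edge F x y + walk_chain y q else 0.

Lemma walk_chain_cat x p q :
  walk_chain x (p ++ q) = walk_chain x p + walk_chain (last x p) q.
Proof. by elim: p x => [|y p IH] x /=; rewrite ?add0r // IH addrA. Qed.

Lemma walk_chain_rev x p :
  walk_chain (last x p) (rev (belast x p)) = - walk_chain x p.
Proof.
elim: p x => [|y p IH] x /=; first by rewrite oppr0.
rewrite rev_cons -cats1 walk_chain_cat IH /= addr0 opprD addrC; congr (_ + _).
rewrite -oriented_edgeC; congr oriented_edge.
by case: (p) => //= z q; rewrite rev_cons last_rcons.
Qed.

Lemma walk_chain_sum x p :
  walk_chain x p =
  \sum_(i < size p) oriented_edge F (nth x (x :: p) i) (nth x p i).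
Proof.
suff W x0 : walk_chain x p =
    \sum_(i < size p) oriented_edge F (nth x0 (x :: p) i) (nth x0 p i) by [].
by elim: p x => [|y p IH] x; rewrite ?big_ord0 // big_ord_recl /= IH.
Qed.

(** Passing from lists, in which walks are concatenated and reversed, to
    cyclically indexed families, with which conflicts are stated. *)
Lemma closed_walk_loop (e : rel T) x p : path e x p -> last x p = x ->
  exists n (y : 'I_n -> T),
    (forall i, e (y i) (y (ordS i))) /\ walk_chain x p = loop_chain y.
Proof.
move=> ep px.
(* The last vertex of the walk repeats x, so the indices stop just before it
   and the last one wraps around to x. *)
exists (size p), (fun i => nth x (x :: p) i).
have next (i : 'I_(size p)) : nth x (x :: p) (ordS i) = nth x p i.
  rewrite /=; have := ltn_ord i; rewrite leq_eqVlt => /orP[/eqP e_i|lt_i].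
    by rewrite e_i modnn -[LHS]px -nth_last [X in X.-1](esym e_i).
  by rewrite modn_small.
split=> [i|]; first by rewrite next; apply: (pathP x ep).
by rewrite walk_chain_sum; apply: eq_bigr => i _; rewrite next.
Qed.

(** * Closed walks span the 1-cycles *)

(** The linear map that sends the vertex [x] to P x and ignores the simplices
    of positive dimension. *)
Definition vertex_lift (P : T -> chain F T) (c : chain F T) : chain F T :=
  \sum_x (c [set x] : F) *: P x.

Fact vertex_lift_is_linear P : linear (vertex_lift P).
Proof.
move=> a c d; rewrite /vertex_lift scaler_sumr -big_split /=.
by apply: eq_bigr => x _; rewrite !ffunE scalerDl scalerA.
Qed.

HB.instance Definition _ P :=
  GRing.isLinear.Build F (chain F T) (chain F T) _ (vertex_lift P)
    (vertex_lift_is_linear P).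

Lemma vertex_lift_vertex P x : vertex_lift P (simplex F [set x]) = P x.
Proof.
rewrite /vertex_lift (bigD1 x) //= ffunE eqxx scale1r big1 ?addr0 // => y nyx.
by rewrite ffunE (inj_eq set1_inj) (negPf nyx) scale0r.
Qed.

(** The map c |-> c - h (d c), with h the lift of the vertices to walks from
    their roots, sends edges to closed walks and fixes the cycles. *)
Lemma cycles1_sub_loops K (W : {vspace chain F T}) :
  (forall n (x : 'I_n -> T),
     (forall i, [set x i; x (ordS i)] \in K) -> loop_chain x \in W) ->
  (cycles F K 1 <= W)%VS.
Proof.
move=> loopW; pose e x y := [set x; y] \in K.
have e_sym : symmetric e by move=> x y; rewrite /e setUC.
pose r := fingraph.root e.
have path_from_root x : {p | path e (r x) p & last (r x) p = x}.
  have /connectP/cid2[p ep /esym px] : connect e (r x) x.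
    by rewrite (sym_connect_sym e_sym) connect_root.
  by exists p.
pose p x := s2val (path_from_root x).
have ep x : path e (r x) (p x) := s2valP (path_from_root x).
have px x : last (r x) (p x) = x := s2valP' (path_from_root x).
pose P x := walk_chain (r x) (p x).
have edgeW x y : e x y -> P x + oriented_edge F x y - P y \in W.
  move=> exy; have rxy : r y = r x.
    apply/eqP; rewrite eq_sym root_connect; last exact: sym_connect_sym.
    exact: connect1.
  pose q := p x ++ y :: rev (belast (r y) (p y)).
  have eq_ : path e (r x) q.
    rewrite cat_path ep px /= exy -{1}(px y) rev_path.
    by rewrite (eq_path (e' := e)) => [|u w]; [exact: ep|exact: e_sym].
  have lq : last (r x) q = r x.
    rewrite last_cat /= -{1}(px y) -rxy.
    by case: (p y) => //= z s; rewrite rev_cons last_rcons.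
  have [n [z [ez qz]]] := closed_walk_loop eq_ lq.
  suff -> : P x + oriented_edge F x y - P y = walk_chain (r x) q.
    by rewrite qz loopW.
  rewrite walk_chain_cat px /= -[X in walk_chain X (rev _)](px y).
  by rewrite walk_chain_rev addrA.
pose h := linfun (vertex_lift P).
have hE x : h (simplex F [set x]) = P x by rewrite lfunE /= vertex_lift_vertex.
have /subvP retractW : (chains F K 1 <= (\1 - (h \o boundary F T))%VF @^-1: W)%VS.
  apply/span_subvP => _ /mapP[A + ->].
  rewrite mem_filter mem_enum => /andP[/eqP/simplex2_oriented[x [y [-> ->]]] xyK].
  rewrite -memv_preim add_lfunE opp_lfunE comp_lfunE id_lfunE.
  rewrite boundary_oriented_edge linearB /= !hE opprB.
  by rewrite addrCA addrA edgeW.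
apply/subvP => c; rewrite memv_cap memv_ker => /andP[/retractW + /eqP dc0].
by rewrite -memv_preim add_lfunE opp_lfunE comp_lfunE id_lfunE dc0 linear0 subr0.
Qed.

Lemma homology_dim_gt0 K k :
  (0 < \dim {: homology F K k})%N <->
  exists z : subvs_of (cycles F K k), hclass z != 0.
Proof.
split=> [dim_gt0|[z z_neq0]]; last first.
  rewrite lt0n dimv_eq0; apply: contraNneq z_neq0 => full0.
  by rewrite -memv0 -full0 memvf.
have [z zE] := vclassP (vpick {: homology F K k}).
by exists z; rewrite /hclass -zE vpick0 -dimv_eq0 -lt0n.
Qed.

End Chains.

(** * Conflicts of a sequence of partitions *)

Section Conflicts.
Variables (R : realType) (F : fieldType) (T : finType).
Variables (theta : R -> {set {set T}}) (s t : R).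
Hypothesis le_s_t : s <= t.
Hypothesis theta_part : forall r, s <= r <= t -> partition (theta r) [set: T].
Local Notation K := (sequence_complex theta s t).

Lemma sequence_complexP (A : {set T}) :
  reflect (exists r C, [/\ s <= r <= t, C \in theta r & A \subset C]) (A \in K).
Proof.
rewrite inE; apply: (iffP (asboolP _)) => -[r [C [rst CT]]] AC;
  exists r, C; split=> //.
  by rewrite powersetE in AC.
by rewrite powersetE.
Qed.

Lemma same_clusterxx r x : s <= r <= t -> same_cluster theta r x x.
Proof.
move=> /theta_part/and3P[/eqP covT _ _].
have /bigcupP[C CT xC] : x \in cover (theta r) by rewrite covT inE.
by exists C.
Qed.

Lemma edge_sequence_complex x y :
  [set x; y] \in K <-> exists2 r, s <= r <= t & same_cluster theta r x y.
Proof.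
split=> [/sequence_complexP[r [C [rst CT]]]|[r rst [C [CT xC yC]]]].
  by rewrite subUset !sub1set => /andP[xC yC]; exists r => //; exists C.
by apply/sequence_complexP; exists r, C; split; rewrite // subUset !sub1set xC yC.
Qed.

(** At a fixed time the clusters are disjoint, so the two clusters through y
    coincide and contain the whole triangle. *)
Lemma triangle_sequence_complex r x y z : s <= r <= t ->
  same_cluster theta r x y -> same_cluster theta r y z -> [set x; y; z] \in K.
Proof.
move=> rst [C [CT xC yC]] [D [DT yD zD]].
have /and3P[_ /trivIsetP tiT _] := theta_part rst.
have CD : C = D.
  apply/eqP; apply: contraT => /(tiT _ _ CT DT)/disjointFr/(_ yC).
  by rewrite yD.
apply/sequence_complexP; exists r, C; split=> //.
by rewrite !subUset !sub1set xC yC CD zD.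
Qed.

(** If every loop of the complex bounded, so would every 1-cycle, as the loops
    span the cycles. *)
Lemma one_conflictP : (1 <= HF F 1 theta s t)%N <-> one_conflict F theta s t.
Proof.
rewrite /HF; split=> [/homology_dim_gt0[z]|[n [x [_ [z _ z_neq0]]]]]; last first.
  by apply/homology_dim_gt0; exists z.
rewrite hclass_eq0; apply: contraPP => no_conflict; apply/negP; rewrite negbK.
apply: (subvP (cycles1_sub_loops _)) (subvsP z) => n x xK {z}.
have xC i : oriented_edge F (x i) (x (ordS i)) \in chains F K 1.
  by rewrite oriented_edge_chains xK orbT.
have zC := loop_chain_cycles xC.
have zE : vsval (Subvs zC) = loop_chain F x by [].
rewrite -zE -hclass_eq0; apply: contra_notT no_conflict => z_neq0.
by exists n, x; split=> //; exists (Subvs zC).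
Qed.

(** Without triangle conflicts, every loop of the complex bounds the cone from
    its first vertex. *)
Lemma one_conflict_triangle :
  one_conflict F theta s t -> triangle_zero_conflict theta s t.
Proof.
apply: contraPP => no_conflict [n [x [xC [z zE]]]].
suff : vsval z \in boundaries F K 1 by rewrite -hclass_eq0 => ->.
rewrite zE; case: n x xC {z zE} => [|n] x xC; first by rewrite big_ord0 mem0v.
have triangle a b c :
    [set a; b] \in K -> [set b; c] \in K -> [set a; b; c] \in K.
  move=> /edge_sequence_complex[r1 r1st ab] /edge_sequence_complex[r2 r2st bc].
  have [r [rst abr bcr]] : exists r, [/\ s <= r <= t, same_cluster theta r a b &
                                         same_cluster theta r b c].
    apply: contra_notP no_conflict => nr.
    by exists a, b, c; split=> //; exists r1, r2.
  exact: triangle_sequence_complex rst abr bcr.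
(* Consecutive vertices may coincide; their edge is then a vertex of K. *)
have diagK a : [set a; a] \in K.
  apply/edge_sequence_complex; exists s; rewrite ?lexx //.
  by apply: same_clusterxx; rewrite lexx.
have xK i : [set x i; x (ordS i)] \in K.
  by have := xC i; rewrite oriented_edge_chains => /orP[/eqP<-|].
(* Adjacency is transitive, so it propagates along the walk. *)
have x0K i : [set x ord0; x i] \in K.
  case: i; elim=> [|i IH] lt_i.
    by rewrite (_ : Ordinal lt_i = ord0) //; apply: val_inj.
  have := triangle _ _ _ (IH (ltnW lt_i)) (xK (Ordinal (ltnW lt_i))).
  rewrite (_ : ordS _ = Ordinal lt_i); last by apply: val_inj; rewrite /= modn_small.
  by move/sequence_complex_down; apply; rewrite setUAC subsetUl.
by apply: (@loop_chain_cone F T K (x ord0)) => i; apply: triangle.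
Qed.

Lemma refines_same_cluster r1 r2 x y : refines (theta r1) (theta r2) ->
  same_cluster theta r1 x y -> same_cluster theta r2 x y.
Proof.
by move=> ref [C [/ref[D DT /subsetP CD] xC yC]]; exists D; split=> //; apply: CD.
Qed.

(** The two clusters of a triangle conflict would persist up to the later time
    if the partitions coarsen, and down to the earlier one if they refine. *)
Lemma hierarchical_no_triangle :
  hierarchical theta s t -> ~ triangle_zero_conflict theta s t.
Proof.
move=> hier [x [y [z [[r1 [r2 [r1st r2st xy yz]]] []]]]].
have [/andP[s1 t1] /andP[s2 t2]] := (r1st, r2st).
case: hier => mono; case: (leP r1 r2) => le12.
- exists r2; split=> //; exact: (refines_same_cluster (mono _ _ s1 le12 t2)).
- exists r1; split=> //; exact: (refines_same_cluster (mono _ _ s2 (ltW le12) t1)).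
- exists r1; split=> //; exact: (refines_same_cluster (mono _ _ s1 le12 t2)).
- exists r2; split=> //; exact: (refines_same_cluster (mono _ _ s2 (ltW le12) t1)).
Qed.

End Conflicts.

Theorem proposition11 (R : realType) (F : fieldType) (T : finType)
    (M : nat) (tp : nat -> R) (theta : R -> {set {set T}}) (s t : R)
    (theta_seq : is_partition_sequence M tp theta)
    (le_t1_s : tp 1%N <= s) (le_s_t : s <= t) :
  [/\ (1 <= HF F 1 theta s t)%N <-> one_conflict F theta s t,
      one_conflict F theta s t -> triangle_zero_conflict theta s t &
      hierarchical theta s t -> HF F 1 theta s t = 0%N].
Proof.
have theta_part r : s <= r <= t -> partition (theta r) [set: T].
  by case: theta_seq => _ _ part _ _ /andP[sr _]; apply/part/(le_trans le_t1_s).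
split=> [||hier]; first exact: one_conflictP.
  exact: one_conflict_triangle.
apply/eqP; rewrite -leqn0 leqNgt; apply/negP => /one_conflictP.
by move/(one_conflict_triangle le_s_t theta_part); apply: hierarchical_no_triangle.
Qed.
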